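(* Let $n\ge 2$, let $A\in\mathbb{Z}^{m\times n}$ be an integral matrix of full column rank, and suppose there is an integer $k\geq 1$ such that every $n\times n$ minor of $A$ lies in $\{0,\pm k,\pm 2k\}$. Then: (1) For every $b\in\mathbb{Z}^m$, $c\in\mathbb{Q}^n$ and every optimal vertex $x^*$ of $\max\{c^\top x: Ax\le b,\ x\in\mathbb{R}^n\}$, if the integer program $\max\{c^\top x : Ax\le b,\ x\in\mathbb{Z}^n\}$ is feasible, then it has an optimal solution $z^*$ with \[ \|x^*-z^*\|_\infty\le\max\{\Delta_{n-1}(A),\Delta_n(A)\}-1\quad\text{and}\quad \|x^*-z^*\|_\infty<\Delta_{n-1}(A). \] (2) For every $b\in\mathbb{Z}^m$ such that $P=\{x\in\mathbb{R}^n:Ax\le b\}$ is full-dimensional, satisfies $P\cap\mathbb{Z}^n=\emptyset$, and each row of $A$ defines a facet of $P$, there exists a row $a^\top$ of $A$ with \[ w^{a}(P)\le \Delta_n(A)-2. \]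
   Context: For $j\in\{1,\dots,n\}$, $\Delta_j(A)$ denotes the maximum of $|\det M|$ over all $j\times j$ submatrices $M$ of $A$. For $a\in\mathbb{R}^n\setminus\{0\}$, $w^{a}(P)=\max_{x\in P}a^\top x-\min_{y\in P}a^\top y$. *)

(* Defs.v *)
From HB Require Import structures.
From mathcomp Require Import all_boot all_order all_algebra.
From mathcomp Require Import boolp classical_sets reals constructive_ereal ereal.

Set Implicit Arguments.
Unset Strict Implicit.
Unset Printing Implicit Defensive.

Import Order.TTheory GRing.Theory Num.Theory.
Local Open Scope ring_scope.

Definition Delta (m n j : nat) (A : 'M[int]_(m, n)) : nat :=
  \max_(f : {ffun 'I_j -> 'I_m} | injectiveb f)
    \max_(g : {ffun 'I_j -> 'I_n} | injectiveb g)
      absz (\det (mxsub f g A)).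

Definition mxR (R : realType) (m n : nat) (A : 'M[int]_(m, n)) : 'M[R]_(m, n) :=
  map_mx (fun z : int => z%:~R) A.

Definition inP (R : realType) (m n : nat) (A : 'M[int]_(m, n)) (b : 'cV[int]_m)
  (x : 'cV[R]_n) : Prop :=
  forall i : 'I_m, (mxR R A *m x) i 0 <= (b i 0)%:~R.

Definition inPZ (m n : nat) (A : 'M[int]_(m, n)) (b : 'cV[int]_m)
  (z : 'cV[int]_n) : Prop :=
  forall i : 'I_m, (A *m z) i 0 <= b i 0.

Definition intvec (R : realType) (n : nat) (z : 'cV[int]_n) : 'cV[R]_n :=
  map_mx (fun t : int => t%:~R) z.

Definition is_vertex (R : realType) (n : nat) (S : 'cV[R]_n -> Prop)
  (x : 'cV[R]_n) : Prop :=
  S x /\ forall (y z : 'cV[R]_n) (t : R), S y -> S z -> 0 < t < 1 ->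
    x = t *: y + (1 - t) *: z -> y = z.

(* the affine hull of S has dimension at least d: S contains d+1 affinely
   independent points *)
Definition affdim_ge (R : realType) (n : nat) (S : 'cV[R]_n -> Prop) (d : nat)
  : Prop :=
  exists pts : 'I_d.+1 -> 'cV[R]_n,
    (forall i, S (pts i)) /\
    \rank (\matrix_(i < d, j < n) (pts (lift ord0 i) j 0 - pts ord0 j 0)) = d.

Definition affdim_eq (R : realType) (n : nat) (S : 'cV[R]_n -> Prop) (d : nat)
  : Prop := affdim_ge S d /\ ~ affdim_ge S d.+1.

Definition full_dim (R : realType) (n : nat) (S : 'cV[R]_n -> Prop) : Prop :=
  affdim_ge S n.

Definition row_facet (R : realType) (m n : nat) (A : 'M[int]_(m, n))
  (b : 'cV[int]_m) (i : 'I_m) : Prop :=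
  exists d : nat,
    affdim_eq (@inP R _ _ A b) d.+1 /\
    affdim_eq (fun x => @inP R _ _ A b x /\ (mxR R A *m x) i 0 = (b i 0)%:~R) d.

Definition norm_inf (R : realType) (n : nat) (v : 'cV[R]_n) : R :=
  \big[Num.max/0]_(i < n) `|v i 0|.

(* w^a(P) = max_{x in P} a^T x - min_{y in P} a^T y, as an extended real
   (sup / inf, which are attained when finite for a polyhedron) *)
Definition width (R : realType) (n : nat) (S : 'cV[R]_n -> Prop)
  (a : 'rV[R]_n) : \bar R :=
  (ereal_sup [set ((a *m x) 0 0)%:E | x in S] -
   ereal_inf [set ((a *m x) 0 0)%:E | x in S])%E.

Definition cdot (R : realType) (n : nat) (c : 'cV[rat]_n) (x : 'cV[R]_n) : R :=
  \sum_(j < n) ratr (c j 0) * x j 0.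

(* Main.v *)
Require Import Defs.
From HB Require Import structures.
From mathcomp Require Import all_boot all_order all_algebra.
From mathcomp Require Import boolp reals constructive_ereal ereal.
From mathcomp Require Import zify ring lra.
Import Order.TTheory GRing.Theory Num.Theory.
Set Implicit Arguments.
Unset Strict Implicit.
Unset Printing Implicit Defensive.
Local Open Scope ring_scope.

(* Let g be the least nonzero absolute value of an n x n minor, so that all of
   them lie in {0, g, 2g}, and let L be the lattice of vectors on which every
   row of A is integral; Z^n has index g in L.
   Among the optimal integer points choose z closest to the vertex v, flip
   signs of rows so that p = v - z satisfies A p >= 0, and decompose p. If p
   is not in L, the rows integral on p form, in a basis of tight rows, a
   totally unimodular system; peeling its extreme rays off p leaves one ray r
   with p - r in L and with the values +-1/2 on the remaining rows, whence
   still A (p - r) >= 0. A vector of L in the cone A y >= 0 is in turn a sum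
   of vectors of L in the cone, each being an extreme ray, half of one, or
   half a sum of two. With g pieces or more, some consecutive pieces would sum
   to an integer vector (pigeonhole in L / Z^n) and z could be moved closer to
   v. So there are at most g - 1 pieces, and Cramer's rule bounds every linear
   form on each of them.
   For flatness, raise right-hand sides on a minimal set of rows for which an
   integer point appears; proximity with one of these rows a_i as objective
   bounds a_i (z - v) by Delta_n - 1, and z violates a_i x <= b_i by 1 or more. *)

Section MaximalMinors.
Variables (m n : nat) (A : 'M[int]_(m, n)).
Implicit Types (h : 'I_n -> 'I_m) (i : 'I_m) (j l : 'I_n).

Definition minor h : int := \det (rowsub h A).

(* The edge of the simplicial cone of the rows [h] along which only the row
   [h j] is nonzero: a column of the inverse matrix, scaled by [|minor h|]. *)
Definition ray h j : 'cV[int]_n :=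
  Num.sg (minor h) *: col j (\adj (rowsub h A)).

Lemma minor_inj h : minor h != 0 -> injective h.
Proof.
move=> h0 x y hxy; apply: contraNeq h0 => nxy; apply/eqP.
by apply: (determinant_alternate nxy) => l; rewrite !mxE hxy.
Qed.

Lemma mulmx_adj_rowsub h i j :
  (A *m \adj (rowsub h A)) i j = minor [eta h with j |-> i].
Proof.
rewrite /minor (expand_det_row _ j) mxE; apply: eq_bigr => l _.
rewrite !mxE /= eqxx; congr (_ * (_ * \det _)).
by apply/matrixP => x y; rewrite !mxE /= eq_sym (negbTE (neq_lift _ _)).
Qed.

Lemma mulmx_ray h j i :
  (A *m ray h j) i 0 = Num.sg (minor h) * minor [eta h with j |-> i].
Proof. by rewrite -scalemxAr -mulmx_adj_rowsub colE mulmxA -colE !mxE. Qed.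

Lemma mulmx_ray_basis h j l :
  (A *m ray h j) (h l) 0 = `|minor h| *+ (l == j).
Proof.
have /matrixP/(_ l j) := mul_mx_adj (rowsub h A).
rewrite mul_rowsub_mx mulmx_ray -mulmx_adj_rowsub [LHS]mxE => ->.
by rewrite mxE mulrnAr [in RHS]normrEsg.
Qed.

Lemma absz_mulmx_ray h j i : minor h != 0 ->
  absz ((A *m ray h j) i 0) = absz (minor [eta h with j |-> i]).
Proof. by move=> h0; rewrite mulmx_ray abszM absz_sg h0 mul1n. Qed.

Lemma ray_singular h j : minor h = 0 -> ray h j = 0.
Proof. by rewrite /ray => ->; rewrite sgr0 scale0r. Qed.

End MaximalMinors.

Lemma map_mx_intr_inj (R : numDomainType) (m n : nat) :
  injective (map_mx intr : 'M[int]_(m, n) -> 'M[R]_(m, n)).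
Proof.
move=> M N /matrixP MN; apply/matrixP => i j; have := MN i j.
by rewrite !mxE => /eqP; rewrite eqr_int => /eqP.
Qed.

Section LinearForms.
Variables (R : comPzRingType) (n : nat).

Definition lform (a : 'rV[int]_n) (y : 'cV[R]_n) : R :=
  (map_mx intr a *m y) 0 0.

Fact lform_is_scalar (a : 'rV[int]_n) : scalar (lform a).
Proof. by move=> c x y; rewrite /lform mulmxDr -scalemxAr !mxE. Qed.

HB.instance Definition _ (a : 'rV[int]_n) :=
  GRing.isLinear.Build R 'cV[R]_n R _ (lform a) (lform_is_scalar a).

Lemma lform0 a : lform a 0 = 0. Proof. exact: linear0. Qed.
Lemma lformN a : {morph lform a : x / - x}. Proof. exact: linearN. Qed.
Lemma lformNl a x : lform (- a) x = - lform a x.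
Proof. by rewrite /lform map_mxN mulNmx mxE. Qed.
Lemma lformD a : {morph lform a : x y / x + y}. Proof. exact: linearD. Qed.
Lemma lformB a : {morph lform a : x y / x - y}. Proof. exact: linearB. Qed.
Lemma lformZ a : scalable_for *%R (lform a). Proof. exact: scalarZ. Qed.

Lemma lform_intr (a : 'rV[int]_n) (z : 'cV[int]_n) :
  lform a (map_mx intr z) = ((a *m z) 0 0)%:~R.
Proof. by rewrite /lform -map_mxM mxE. Qed.

Lemma lform_delta (l : 'I_n) (y : 'cV[R]_n) : lform (delta_mx 0 l) y = y l 0.
Proof. by rewrite /lform map_delta_mx -rowE mxE. Qed.

End LinearForms.

Local Notation rowval A i := (lform (row i A)).

Section RowValues.
Variables (R : comPzRingType) (m n : nat) (A : 'M[int]_(m, n)).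
Implicit Types (y : 'cV[R]_n) (z : 'cV[int]_n) (h : 'I_n -> 'I_m).

Lemma rowvalE i y : rowval A i y = (map_mx intr A *m y) i 0.
Proof. by rewrite /lform map_row -row_mul mxE. Qed.

Lemma rowval_intr i z : rowval A i (map_mx intr z) = ((A *m z) i 0)%:~R :> R.
Proof. by rewrite lform_intr -row_mul mxE. Qed.

Lemma cramer h y :
  `|minor A h|%:~R *: y = \sum_j rowval A (h j) y *: map_mx intr (ray A h j).
Proof.
pose M : 'M[R]_n := map_mx intr (rowsub h A).
have adjM : (minor A h)%:~R *: y = \adj M *m (M *m y).
  by rewrite mulmxA mul_adj_mx mul_scalar_mx det_map_mx.
rewrite normrEsg intrM -scalerA adjM.
apply/matrixP => l c; rewrite ord1 !mxE summxE mulr_sumr; apply: eq_bigr => j _.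
rewrite rowvalE /M -map_mx_adj !mxE intrM mulrA mulrC; congr (_ * _).
by apply: eq_bigr => k _; rewrite !mxE.
Qed.

Lemma cramer_edge h j0 y : (forall j, j != j0 -> rowval A (h j) y = 0) ->
  `|minor A h|%:~R *: y = rowval A (h j0) y *: map_mx intr (ray A h j0).
Proof.
move=> y0; rewrite cramer (bigD1 j0) //= big1 ?addr0 // => j /y0 ->.
exact: scale0r.
Qed.

End RowValues.

Section Bases.
Variables (R : numFieldType) (m n : nat) (A : 'M[int]_(m, n)).
Implicit Types (x y d : 'cV[R]_n) (h : 'I_n -> 'I_m) (S : pred 'I_m).

Definition pointed S := forall d, (forall i, S i -> rowval A i d = 0) -> d = 0.

Lemma basis_eq0 h y :
  minor A h != 0 -> (forall j, rowval A (h j) y = 0) -> y = 0.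
Proof.
move=> h0 y0; apply/eqP; have := cramer A h y.
rewrite big1 => [/eqP|j _]; last by rewrite y0 scale0r.
by rewrite scaler_eq0 intr_eq0 normr_eq0 (negbTE h0).
Qed.

Lemma basis_pointed h S : minor A h != 0 -> (forall j, S (h j)) -> pointed S.
Proof. by move=> h0 Sh d d0; apply: (basis_eq0 h0) => j; apply: d0. Qed.

Lemma pointed_basis S : pointed S ->
  exists2 h, forall j, S (h j) & minor A h != 0.
Proof.
move=> pS; pose X : 'M[R]_(m, n) :=
  \matrix_(i, j) if S i then (A i j)%:~R else 0.
have fullX : row_full X.
  rewrite -cokermx_eq0; apply/eqP/matrixP => i j; rewrite [RHS]mxE.
  suff /matrixP/(_ i 0) : col j (cokermx X) = 0 by rewrite !mxE.
  apply: pS => l Sl; have /matrixP/(_ l j) := mulmx_coker X.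
  rewrite [RHS]mxE => <-; rewrite rowvalE !mxE; apply: eq_bigr => x _.
  by rewrite !mxE Sl.
have := fullrowsub_unit fullX; set h := fullrankfun fullX => unitX.
have Sh j : S (h j).
  apply: contraLR unitX => /negbTE nS; rewrite unitmxE (expand_det_row _ j).
  by rewrite big1 ?unitr0 // => l _; rewrite !mxE nS mul0r.
exists h => //; move: unitX; rewrite unitmxE unitfE.
suff -> : rowsub h X = map_mx intr (rowsub h A) by rewrite det_map_mx intr_eq0.
by apply/matrixP=> x y; rewrite !mxE Sh.
Qed.

Definition basic_point (beta : 'I_m -> R) h : 'cV[R]_n :=
  invmx (map_mx intr (rowsub h A)) *m \col_j beta (h j).

Lemma basic_pointP beta h x : minor A h != 0 ->
  (forall j, rowval A (h j) x = beta (h j)) <-> x = basic_point beta h.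
Proof.
move=> h0; set M : 'M[R]_n := map_mx intr (rowsub h A).
have uM : M \in unitmx by rewrite unitmxE unitfE det_map_mx intr_eq0.
have rowM j : rowval A (h j) x = (M *m x) j 0.
  by rewrite rowvalE !mxE; apply: eq_bigr => l _; rewrite !mxE.
split=> [xb|xE j].
  rewrite -[LHS](mulKmx uM); congr (_ *m _); apply/matrixP => j l.
  by rewrite ord1 -rowM xb mxE.
by rewrite rowM xE mulKVmx // mxE.
Qed.

End Bases.

Section LinearPrograms.
Variables (R : realFieldType) (m n : nat) (A : 'M[int]_(m, n)).
Variables (S : pred 'I_m) (beta : 'I_m -> R).
Implicit Types (x y d : 'cV[R]_n) (h : 'I_n -> 'I_m) (c : {scalar 'cV[R]_n}).

Definition feasible x := forall i, S i -> rowval A i x <= beta i.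

Lemma feasible_direction x d : feasible x ->
    (forall i, S i -> rowval A i x = beta i -> rowval A i d <= 0) ->
  exists2 e, 0 < e & feasible (x + e *: d).
Proof.
move=> xP dt; pose slack i := beta i - rowval A i x.
pose e := \big[Num.min/1]_(i | S i && (slack i != 0))
  (slack i / (1 + `|rowval A i d|)).
have d1 i : 0 < 1 + `|rowval A i d| by rewrite ltr_wpDr.
have slack0 i : S i -> 0 <= slack i by move=> Si; rewrite subr_ge0 xP.
have e0 : 0 < e.
  by apply: lt_bigmin => // i /andP[Si si];
    rewrite divr_gt0 // lt_def si slack0.
exists e => // i Si; rewrite lformD lformZ -lerBrDl -/(slack i).
have [si|si] := eqVneq (slack i) 0.
  rewrite si mulr_ge0_le0 ?dt ?(ltW e0) //.
  by rewrite -[LHS](subKr (beta i)) -/(slack i) si subr0.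
apply: (@le_trans _ _ (e * (1 + `|rowval A i d|))).
  by rewrite ler_pM2l // (le_trans (ler_norm _)) // lerDr.
by rewrite -ler_pdivlMr // bigmin_le_cond // Si.
Qed.

Lemma ratio_test x d i1 : feasible x -> S i1 -> 0 < rowval A i1 d ->
  exists t i, [/\ 0 <= t, S i, 0 < rowval A i d, feasible (x + t *: d) &
                  rowval A i (x + t *: d) = beta i].
Proof.
move=> xP Si1 di1; pose ratio i := (beta i - rowval A i x) / rowval A i d.
pose P := [pred i | S i && (0 < rowval A i d)].
have Pi1 : P i1 by rewrite /= Si1.
case: (arg_minP ratio Pi1) => i /andP[Si di] ratio_min; exists (ratio i), i.
have t0 : 0 <= ratio i by rewrite divr_ge0 ?subr_ge0 ?xP // ltW.
split=> // [l Sl|]; rewrite lformD lformZ; last first.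
  by rewrite divfK ?gt_eqF // addrC subrK.
rewrite -lerBrDl; have [dl|dl] := ltP 0 (rowval A l d).
  by rewrite -ler_pdivlMr //; apply: ratio_min; rewrite /= Sl.
by apply: le_trans (_ : 0 <= _); [exact: mulr_ge0_le0 | rewrite subr_ge0 xP].
Qed.

Definition recession_bounded c :=
  forall d, (forall i, S i -> rowval A i d <= 0) -> c d <= 0.

Hypothesis pS : pointed R A S.

Lemma pointed_exists_gt0 y : (forall i, S i -> 0 <= rowval A i y) -> y <> 0 ->
  exists2 i, S i & 0 < rowval A i y.
Proof.
move=> y0 yn; apply: contrapT => no_pos; apply/yn/pS => i Si; apply/eqP.
rewrite eq_le y0 // andbT leNgt; apply/negP => yi.
by apply: no_pos; exists i.
Qed.

Lemma improving_direction c d0 (T : 'I_m -> Prop) :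
    recession_bounded c -> d0 <> 0 -> (forall i, T i -> rowval A i d0 = 0) ->
  exists d, [/\ forall i, T i -> rowval A i d = 0, 0 <= c d &
                exists2 i, S i & 0 < rowval A i d].
Proof.
move=> c_bounded; wlog cd0 : d0 / 0 <= c d0 => [wlog_c d0n d0T|d0n d0T].
  have [|cd0] := leP 0 (c d0); first by move/wlog_c; apply.
  apply: (wlog_c (- d0)); rewrite ?linearN ?oppr_ge0 1?ltW //.
    by move=> /eqP; rewrite oppr_eq0 => /eqP.
  by move=> i /d0T; rewrite lformN => ->; rewrite oppr0.
have [di|no_pos] := pselect (exists2 i, S i & 0 < rowval A i d0);
  first by exists d0.
have d0_le0 i : S i -> rowval A i d0 <= 0.
  by move=> Si; rewrite leNgt; apply/negP => di; apply: no_pos; exists i.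
exists (- d0); split=> [i /d0T|| ].
- by rewrite lformN => ->; rewrite oppr0.
- by rewrite linearN oppr_ge0 c_bounded.
apply: pointed_exists_gt0 => [i /d0_le0|/eqP]; first by rewrite lformN oppr_ge0.
by rewrite oppr_eq0 => /eqP.
Qed.

Lemma tight_basis c x : feasible x -> recession_bounded c ->
  exists y h, [/\ feasible y, c x <= c y,
    forall i, S i -> rowval A i x = beta i -> rowval A i y = beta i,
    forall j, S (h j) /\ rowval A (h j) y = beta (h j) & minor A h != 0].
Proof.
move=> + c_bounded.
have [N] := ubnP #|[pred i | S i && (rowval A i x != beta i)]|.
elim: N x => // N IH x /ltnSE leN xP.
pose T := [pred i | S i && (rowval A i x == beta i)].
have [pT|/existsNP[d0 /not_implyP[d0T d0n]]] := pselect (pointed R A T).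
  have [h Th h0] := pointed_basis pT; exists x, h; split=> // j.
  by case/andP: (Th j) => ? /eqP.
have [d [dT cd [i1 Si1 di1]]] := improving_direction c_bounded d0n d0T.
have [t [i2 [t0 Si2 di2 xdP i2t]]] := ratio_test xP Si1 di1.
have tight_stays i : S i -> rowval A i x = beta i ->
    rowval A i (x + t *: d) = beta i.
  by move=> Si xi; rewrite lformD lformZ dT ?mulr0 ?addr0 //= Si xi eqxx.
have [|y [h [yP cy yt hB h0]]] := IH (x + t *: d) _ xdP.
  apply: leq_trans leN; apply: proper_card; apply/properP; split.
    apply/fintype.subsetP => i; rewrite !inE => /andP[Si xdi]; rewrite Si /=.
    by apply: contra xdi => /eqP /tight_stays ->.
  exists i2; rewrite !inE Si2 /= ?i2t ?eqxx //.
  by apply: contraTneq di2 => xi2; rewrite dT ?ltxx //= Si2 xi2 eqxx.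
exists y, h; split=> // [|i Si xi]; last by apply: yt => //; apply: tight_stays.
by apply: le_trans cy; rewrite linearD scalarZ lerDl mulr_ge0.
Qed.

Lemma lp_optimal_basis c : (exists x, feasible x) -> recession_bounded c ->
  exists x h, [/\ feasible x, forall y, feasible y -> c y <= c x,
    forall j, rowval A (h j) x = beta (h j) & minor A h != 0].
Proof.
move=> [x0 x0P] c_bounded; pose bp := basic_point A beta.
pose P (h : {ffun 'I_n -> 'I_m}) :=
  (minor A h != 0) && [forall (i | S i), rowval A i (bp h) <= beta i].
have dominated x : feasible x -> exists2 h, P h & c x <= c (bp h).
  move=> /tight_basis/(_ c_bounded)[y [h [yP cxy _ hB h0]]].
  have hE : finfun h = h :> (_ -> _) by apply: funext => j; rewrite ffunE.
  have yE : y = bp h by apply/basic_pointP => // j; case: (hB j).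
  exists (finfun h); rewrite /P hE -?yE // h0 /=; exact/forall_inP.
have [h0 Ph0 _] := dominated _ x0P.
case: (arg_maxP (fun h : {ffun _} => c (bp h)) Ph0) =>
  h /andP[hn /forall_inP hP] h_max.
exists (bp h), h; split=> // [y /dominated[h' /h_max bp_le c_le]|].
  exact: le_trans c_le bp_le.
by apply/basic_pointP.
Qed.

End LinearPrograms.

Section ExtremeRays.
Variables (R : realFieldType) (m n : nat) (A : 'M[int]_(m, n)) (S : pred 'I_m).

(* A vertex of the slice [rowval A i0 y = rowval A i0 u] of the cone. *)
Lemma extreme_ray (u : 'cV[R]_n) i0 : pointed R A S ->
    (forall i, S i -> 0 <= rowval A i u) -> S i0 -> 0 < rowval A i0 u ->
  exists h j0, [/\ forall j, S (h j), h j0 = i0, minor A h != 0,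
    forall i, S i -> 0 <= (A *m ray A h j0) i 0 &
    forall i, S i -> rowval A i u = 0 -> (A *m ray A h j0) i 0 = 0].
Proof.
move=> pS u0 Si0 ui0; pose beta i := if i == i0 then - rowval A i0 u else 0.
have uP : feasible A S beta (- u).
  by move=> i Si; rewrite lformN /beta; case: eqP => [->|_] //;
    rewrite oppr_le0 u0.
have [d _|y [h [yP _ yt hB h0]]] := tight_basis pS (c := \0) uP;
  first exact: lexx.
have yi0 : rowval A i0 y = - rowval A i0 u.
  by rewrite yt // /beta ?eqxx // lformN.
have [j0 hj0] : exists j0, h j0 = i0.
  apply: contrapT => /forallNP nh; suff y0 : y = 0.
    by move: yi0; rewrite y0 lform0 => /esym/eqP; rewrite oppr_eq0 gt_eqF.
  by apply: (basis_eq0 h0) => j; case: (hB j) => _ ->; rewrite /beta;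
    case: eqP => // /nh.
have y_edge j : j != j0 -> rowval A (h j) y = 0.
  move=> jj0; case: (hB j) => _ ->; rewrite /beta; case: eqP => // hj.
  by case/eqP: jj0; apply: (minor_inj h0); rewrite hj.
have rayE i : rowval A i0 u * ((A *m ray A h j0) i 0)%:~R
    = `|minor A h|%:~R * - rowval A i y.
  have := congr1 (rowval A i) (cramer_edge y_edge).
  by rewrite !lformZ rowval_intr hj0 yi0 mulrN => ->; rewrite mulNr opprK.
have ray_sg i : rowval A i y <= 0 -> 0 <= (A *m ray A h j0) i 0.
  by move=> yi; rewrite -(ler0z R) -(pmulr_rge0 _ ui0) rayE mulr_ge0 ?oppr_ge0.
exists h, j0; split=> // [j|i Si|i Si ui]; first by case: (hB j).
  apply/ray_sg/(le_trans (yP i Si)); rewrite /beta; case: ifP => // _.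
  by rewrite oppr_le0 ltW.
have ii0 : i != i0 by apply: contraTneq ui0 => <-; rewrite ui ltxx.
have betai : beta i = 0 by rewrite /beta (negbTE ii0).
apply/eqP; rewrite -(intr_eq0 R) -(mulrI_eq0 _ (lregP (lt0r_neq0 ui0))) rayE.
by rewrite yt // betai ?oppr0 ?mulr0 // lformN ui oppr0.
Qed.

End ExtremeRays.

Section Archimedean.
Variable R : archiRealFieldType.
Implicit Types x y : R.

Lemma archi_descent (T : Type) (f : T -> R) (P : T -> Prop) :
    (forall t, (forall u, 0 <= f u <= f t - 1 -> P u) -> P t) ->
  forall t, P t.
Proof.
move=> descent t; have : f t < (Num.bound `|f t|)%:R.
  exact: le_lt_trans (ler_norm _) (archi_boundP (normr_ge0 _)).
move: (Num.bound _) => N; elim: N t => [|N IH] t tN;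
  apply: descent => u /andP[u0 ut].
  by move: tN; lra.
by apply: IH; move: tN; rewrite -natr1; lra.
Qed.

Lemma intr_gt0_ge1 x : x \is a Num.int -> 0 < x -> 1 <= x.
Proof. by move=> /intrP[z ->]; rewrite ltr0z ler1z gtz0_ge1. Qed.

Lemma half_intP x : 2 * x \is a Num.int -> x \isn't a Num.int ->
  exists b : int, x = b%:~R + 2^-1.
Proof.
move=> /intrP[a xa] nx; exists (a %/ 2)%Z.
have [a0|a1] : (a %% 2)%Z = 0 \/ (a %% 2)%Z = 1 by lia.
  suff xE : x = (a %/ 2)%Z%:~R by rewrite xE rpred_int in nx.
  by move: xa; rewrite {1}(divz_eq a 2) a0 addr0 intrM; lra.
by move: xa; rewrite {1}(divz_eq a 2) a1 intrD intrM; lra.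
Qed.

Lemma half_int_sub x y : 2 * x \is a Num.int -> 2 * y \is a Num.int ->
  x \isn't a Num.int -> y \isn't a Num.int -> x - y \is a Num.int.
Proof.
move=> x2 y2 /(half_intP x2)[b ->] /(half_intP y2)[c ->].
by rewrite opprD addrACA subrr addr0 rpredB // rpred_int.
Qed.

Lemma half_int_ge x : 2 * x \is a Num.int -> x \isn't a Num.int -> 0 <= x ->
  2^-1 <= x.
Proof.
move=> x2 /(half_intP x2)[b ->]; rewrite lerDr ler0z => x0.
rewrite leNgt; apply/negP; rewrite -lezD1 -(ler_int R) intrD; lra.
Qed.

Lemma half_value_le (a b : R) : a \in [:: 0; 1; 2] -> 0 <= b ->
  (a != 0 -> 1 <= b) -> 2^-1 * a <= b.
Proof.
rewrite !inE => /or3P[] /eqP -> b0; first by rewrite mulr0.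
  by move=> /(_ (oner_neq0 _)); lra.
by rewrite pnatr_eq0 => /(_ isT); lra.
Qed.

End Archimedean.

Section Gauge.
Variables (R : numDomainType) (m n : nat) (A : 'M[int]_(m, n)).
Implicit Types (y u : 'cV[R]_n) (h : 'I_n -> 'I_m) (c d : R).

(* [y] belongs to [c] times the convex hull of the vectors [+- ray A h j], in
   the dual form; unit forms [a] and rows [a] of [A] turn [M] into bounds on
   the minors of order [n - 1] and [n] respectively. *)
Definition gauge_le y c := forall (a : 'rV[int]_n) (M : nat),
  (forall h j, (absz ((a *m ray A h j) 0%R 0%R) <= M)%N) ->
    `|lform a y| <= M%:R * c.

Lemma gauge_le0 : gauge_le 0 0.
Proof. by move=> a M _; rewrite lform0 normr0 mulr0. Qed.

Lemma gauge_leD y u c d : gauge_le y c -> gauge_le u d ->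
  gauge_le (y + u) (c + d).
Proof.
move=> yc ud a M aM; rewrite lformD mulrDr.
by apply: le_trans (ler_normD _ _) _; apply: lerD; [exact: yc | exact: ud].
Qed.

Lemma gauge_leW y c d : c <= d -> gauge_le y c -> gauge_le y d.
Proof. by move=> cd yc a M /yc /le_trans; apply; rewrite ler_wpM2l. Qed.

Lemma gauge_le_sum (ys : seq 'cV[R]_n) c :
  {in ys, forall y, gauge_le y c} ->
    gauge_le (\sum_(y <- ys) y) ((size ys)%:R * c).
Proof.
elim: ys => [_|y ys IH ysc]; first by rewrite big_nil mul0r; apply: gauge_le0.
rewrite big_cons /= -natr1 mulrDl mul1r addrC; apply: gauge_leD.
  by apply: IH => u u_ys; apply: ysc; rewrite inE u_ys orbT.
by apply: ysc; rewrite mem_head.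
Qed.

Lemma gauge_le_ray h j c : gauge_le (c *: map_mx intr (ray A h j)) `|c|.
Proof.
move=> a M aM; rewrite lformZ lform_intr normrM mulrC ler_wpM2r //.
by rewrite -intr_norm -natr_absz ler_nat.
Qed.

End Gauge.

Section RowLattice.
Variables (R : archiRealFieldType) (m n : nat) (A : 'M[int]_(m, n)).

Definition row_lattice : {pred 'cV[R]_n} :=
  [pred y | [forall i, rowval A i y \is a Num.int]].

Lemma row_latticeP y :
  reflect (forall i, rowval A i y \is a Num.int) (y \in row_lattice).
Proof. exact: forallP. Qed.

Fact row_lattice_zmod_closed : zmod_closed row_lattice.
Proof.
split=> [|x y /row_latticeP xL /row_latticeP yL]; apply/row_latticeP => i.
  by rewrite lform0 rpred0.
by rewrite lformB rpredB.
Qed.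

HB.instance Definition _ :=
  GRing.isZmodClosed.Build 'cV[R]_n row_lattice row_lattice_zmod_closed.

End RowLattice.

Arguments row_latticeP {R m n A y}.

Section BasisLattices.
Variables (R : archiRealFieldType) (m n : nat) (A : 'M[int]_(m, n)).
Implicit Types (y : 'cV[R]_n) (h : 'I_n -> 'I_m).

Lemma basis_latticeP h y : reflect (forall j, rowval A (h j) y \is a Num.int)
  (y \in row_lattice (rowsub h A)).
Proof.
have rowE j : row j (rowsub h A) = row (h j) A by apply/rowP => l; rewrite !mxE.
by apply: (iffP row_latticeP) => yP j; have := yP j; rewrite rowE.
Qed.

Lemma basis_lattice_rowval h i y (c : int) : minor A h != 0 ->
    y \in row_lattice (rowsub h A) ->
    (forall j, (minor A h %| c * minor A [eta h with j |-> i])%Z) ->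
  c%:~R * rowval A i y \is a Num.int.
Proof.
move=> h0 /basis_latticeP yP dvd_c; pose D : int := `|minor A h|.
have D0 : D%:~R != 0 :> R by rewrite intr_eq0 normr_eq0.
have dvd_ray j : (D %| c * (A *m ray A h j) i 0%R)%Z.
  by have := dvd_c j; rewrite !dvdzE !abszM absz_mulmx_ray // /D abszE absz_nat.
have DE : D%:~R * (c%:~R * rowval A i y) =
    D%:~R * \sum_j rowval A (h j) y * ((c * (A *m ray A h j) i 0%R) %/ D)%Z%:~R.
  rewrite mulrCA -lformZ cramer raddf_sum /= !mulr_sumr; apply: eq_bigr => j _.
  rewrite lformZ rowval_intr [RHS]mulrCA -intrM [D * _]mulrC divzK // intrM.
  by rewrite mulrCA.
by rewrite (mulfI D0 DE) rpred_sum // => j _; rewrite rpredM // rpred_int.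
Qed.

End BasisLattices.

Arguments basis_latticeP {R m n A h y}.

Definition bimodular (m n : nat) (g : nat) (A : 'M[int]_(m, n)) :=
  forall h, absz (minor A h) \in [:: 0; g; 2 * g]%N.

Definition in_cone (R : numDomainType) (m n : nat) (A : 'M[int]_(m, n))
  (y : 'cV[R]_n) := forall i, 0 <= rowval A i y.

Section BimodularLattice.
Variables (R : archiRealFieldType) (m n g : nat) (A : 'M[int]_(m, n)).
Hypotheses (g0 : (0 < g)%N) (bimA : bimodular g A).
Implicit Types (p q r y w : 'cV[R]_n) (h : 'I_n -> 'I_m).
Local Notation L := (row_lattice A).
Local Notation "'L_ h" := (row_lattice (rowsub h A)) (at level 8, h at level 2).

Let gR : 0 < g%:R :> R. Proof. by rewrite ltr0n. Qed.

Lemma minimal_basis_lattice h y : absz (minor A h) = g -> y \in 'L_h -> y \in L.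
Proof.
move=> hg yh; apply/row_latticeP => i; rewrite -[rowval A i y]mul1r.
apply: (basis_lattice_rowval (c := 1)) yh _ => [|j];
  first by rewrite -absz_gt0 hg.
rewrite mul1r dvdzE hg; have := bimA [eta h with j |-> i]; rewrite !inE.
by case/or3P=> /eqP ->; rewrite ?dvdn0 ?dvdnn ?dvdn_mull.
Qed.

Lemma basis_lattice_half_int h y i : minor A h != 0 -> y \in 'L_h ->
  2 * rowval A i y \is a Num.int.
Proof.
move=> h0 yh; apply: (basis_lattice_rowval (c := 2) h0 yh) => j.
rewrite dvdzE abszM; have := bimA [eta h with j |-> i]; have := bimA h.
rewrite !inE absz_eq0 (negbTE h0) /=.
by case/orP=> /eqP -> /or3P[] /eqP ->;
  do ?[exact: dvdn0 | exact: dvdnn | apply: dvdn_mull].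
Qed.

Lemma nonlattice_basis_minor h y : minor A h != 0 -> y \in 'L_h -> y \notin L ->
  absz (minor A h) = (2 * g)%N.
Proof.
move=> h0 yh yL; have := bimA h; rewrite !inE absz_eq0 (negbTE h0) /=.
by case/orP=> /eqP // /minimal_basis_lattice/(_ yh); rewrite (negbTE yL).
Qed.

(* Exchanging a suitable row of [h] for a row non-integral on [q] yields a basis
   of minor [g], so a vector of ['L_h] has only one fractional class. *)
Lemma basis_lattice_dichotomy h q y :
    minor A h != 0 -> q \in 'L_h -> q \notin L ->
    (forall i, rowval A i q \is a Num.int -> rowval A i y \is a Num.int) ->
  y \in L \/ q - y \in L.
Proof.
move=> h0 qh qL yq.
have qh_int := basis_latticeP qh.
have [i qi] : exists i, rowval A i q \isn't a Num.int.
  by apply/existsP; rewrite -negb_forall.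
have [j hjg] : exists j, absz (minor A [eta h with j |-> i]) = g.
  apply: contrapT => /forallNP no_g; case/negP: qi;
    rewrite -[rowval A i q]mul1r.
  apply: (basis_lattice_rowval (c := 1) h0 qh) => j.
  rewrite mul1r dvdzE (nonlattice_basis_minor h0 qh qL).
  have := bimA [eta h with j |-> i]; rewrite !inE.
  by case/or3P=> /eqP hj; rewrite ?hj ?dvdn0 ?dvdnn //; case: (no_g j).
have in_L (x : 'cV[R]_n) : (forall l, rowval A (h l) x \is a Num.int) ->
    rowval A i x \is a Num.int -> x \in L.
  move=> xh xi; apply: (minimal_basis_lattice hjg);
    apply/basis_latticeP => l /=.
  by case: eqP.
have yh l : rowval A (h l) y \is a Num.int by apply/yq.
have [yi|yi] := boolP (rowval A i y \is a Num.int); [left | right];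
  apply: in_L => //.
  by move=> l; rewrite lformB rpredB.
rewrite lformB half_int_sub // (basis_lattice_half_int _ h0) //.
exact/basis_latticeP.
Qed.

Definition scaled_ray h j : 'cV[R]_n := g%:R^-1 *: map_mx intr (ray A h j).

Lemma rowval_scaled_ray h j i :
  rowval A i (scaled_ray h j) = ((A *m ray A h j) i 0)%:~R / g%:R.
Proof. by rewrite lformZ rowval_intr mulrC. Qed.

Lemma norm_scaled_ray h j i : minor A h != 0 ->
  `|rowval A i (scaled_ray h j)| =
    (absz (minor A [eta h with j |-> i]))%:R / g%:R.
Proof.
move=> h0; rewrite rowval_scaled_ray normrM normfV (gtr0_norm gR);
  congr (_ / _).
by rewrite -intr_norm -natr_absz absz_mulmx_ray.
Qed.

Lemma norm_scaled_ray_in h j i : minor A h != 0 ->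
  `|rowval A i (scaled_ray h j)| \in [:: 0; 1; 2].
Proof.
move=> h0; rewrite norm_scaled_ray //; have := bimA [eta h with j |-> i].
rewrite !inE => /or3P[] /eqP ->; first by rewrite mul0r eqxx.
  by rewrite divff ?(gt_eqF gR) // eqxx orbT.
by rewrite natrM mulfK ?(gt_eqF gR) // eqxx !orbT.
Qed.

Lemma gauge_le_scaled_ray h j c : 0 <= c ->
  gauge_le A (c *: scaled_ray h j) (c / g%:R).
Proof.
move=> c0; rewrite scalerA -[X in gauge_le _ _ X]ger0_norm ?divr_ge0 //.
exact: gauge_le_ray.
Qed.

Section Rounding.
Variables (h0 : 'I_n -> 'I_m).
Hypothesis h0n : minor A h0 != 0.

Lemma peel_ray q : q \in 'L_h0 -> q \notin L ->
    (forall i, rowval A i q \is a Num.int -> 0 <= rowval A i q) ->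
  exists h j, let r := 2^-1 *: scaled_ray h j in [/\ minor A h != 0,
    forall i, rowval A i q \is a Num.int ->
      rowval A i r \is a Num.int /\ 0 <= rowval A i r <= rowval A i q &
    exists2 i, rowval A i q \is a Num.int & rowval A i r = 1].
Proof.
move=> qh qL q0; pose S := [pred i | rowval A i q \is a Num.int].
have pS : pointed R A S := basis_pointed h0n (basis_latticeP qh).
have [i0 Si0 qi0] : exists2 i, S i & 0 < rowval A i q.
  by apply: (pointed_exists_gt0 pS) => // q_eq0; rewrite q_eq0 rpred0 in qL.
have [h [j [Sh hj hn ray0 ray_face]]] := extreme_ray pS q0 Si0 qi0.
have minor_S h' : minor A h' != 0 -> (forall l, S (h' l)) ->
    absz (minor A h') = (2 * g)%N.
  by move=> h'n Sh'; apply: nonlattice_basis_minor qL => //;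
    apply/basis_latticeP.
have half_double : 2^-1 * ((2 * g)%:R / g%:R) = 1 :> R.
  by rewrite natrM mulfK ?mulVf ?pnatr_eq0 // gt_eqF.
have rE i : S i -> 2^-1 * rowval A i (scaled_ray h j) =
    (minor A [eta h with j |-> i] != 0)%:R.
  move=> Si; have u0 : 0 <= rowval A i (scaled_ray h j).
    by rewrite rowval_scaled_ray divr_ge0 // ler0z ray0.
  rewrite -(ger0_norm u0) norm_scaled_ray //.
  case: eqVneq => [->|hi]; first by rewrite mul0r mulr0.
  by rewrite minor_S ?half_double // => l /=; case: eqP => _;
    [exact: Si | exact: Sh].
exists h, j; split=> // [i Si|]; last first.
  exists i0 => //; rewrite lformZ rowval_scaled_ray -hj mulmx_ray_basis eqxx.
  by rewrite -natr_absz minor_S.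
rewrite lformZ rE //; case: eqVneq => [_|hi]; first by rewrite rpred0 lexx q0.
suff qi1 : 1 <= rowval A i q by rewrite rpred1 ler01 qi1.
apply: intr_gt0_ge1 => //; rewrite lt_def (q0 i Si) andbT.
apply: contraNneq hi => /(ray_face i Si) rayi.
by rewrite -absz_eq0 -absz_mulmx_ray // rayi.
Qed.

Lemma odd_ray q : q \in 'L_h0 -> q \notin L ->
    (forall i, rowval A i q \is a Num.int -> 0 <= rowval A i q) ->
  exists h j, let r := 2^-1 *: scaled_ray h j in
    [/\ minor A h != 0, q - r \in L &
    forall i, rowval A i q \is a Num.int -> 0 <= rowval A i r <= rowval A i q].
Proof.
pose f (q : 'cV[R]_n) := \sum_(i | rowval A i q \is a Num.int) rowval A i q.
elim/(archi_descent (f := f)): q => q IH qh qL q0.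
have [h [j [hn r_le [i0 qi0 ri0]]]] := peel_ray qh qL q0.
set r := 2^-1 *: scaled_ray h j in r_le ri0 *.
have r_int i : rowval A i q \is a Num.int -> rowval A i r \is a Num.int.
  by move=> /r_le[].
have [rL|qrL] := basis_lattice_dichotomy h0n qh qL r_int; last first.
  by exists h, j; split=> // i /r_le[].
have q'_int i :
    (rowval A i (q - r) \is a Num.int) = (rowval A i q \is a Num.int).
  by rewrite lformB rpredBr //; apply/row_latticeP.
have q'_le i : rowval A i q \is a Num.int ->
    0 <= rowval A i (q - r) <= rowval A i q.
  by move=> /r_le[_ /andP[r0 rq]]; rewrite lformB subr_ge0 rq gerBl.
have [|||i|h' [j' [h'n q'r'L r'_le]]] := IH (q - r).
- rewrite sumr_ge0 => [/=|i]; last by rewrite q'_int => /q'_le/andP[].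
  rewrite /f (eq_bigl _ _ q'_int) (eq_bigr _ (fun i _ => lformB _ _ _)) sumrB.
  rewrite lerD2l lerN2 (bigD1 i0) //= ri0 lerDl sumr_ge0 // => i.
  by case/andP=> /r_le[_ /andP[]].
- apply/basis_latticeP => l; rewrite q'_int; exact: (basis_latticeP qh).
- by rewrite rpredBr.
- by rewrite q'_int => /q'_le/andP[].
exists h', j'; split=> // [|i qi].
  by rewrite -(subrK r q) addrAC rpredD.
have := r'_le i; rewrite q'_int => /(_ qi)/andP[-> /le_trans]; apply.
by case/andP: (q'_le i qi).
Qed.

Lemma lattice_rounding p : p \in 'L_h0 -> p \notin L -> in_cone A p ->
  exists w, [/\ w \in L,
    forall i, 0 <= rowval A i w
      <= rowval A i p + (rowval A i p \isn't a Num.int)%:R / 2 &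
    gauge_le A (p - w) (2 * g)%:R^-1].
Proof.
move=> ph pL p0; have [h [j [hn wL r_le]]] := odd_ray ph pL (fun i _ => p0 i).
set r := 2^-1 *: scaled_ray h j in wL r_le.
exists (p - r); split=> // [i|]; last first.
  by rewrite subKr natrM invfM; apply: gauge_le_scaled_ray; rewrite invr_ge0.
rewrite lformB; have [pi|pi] := boolP (rowval A i p \is a Num.int).
  by rewrite mul0r addr0 subr_ge0 gerBl; case/andP: (r_le i pi) => -> ->.
have r_notint : rowval A i r \isn't a Num.int.
  apply: contra pi => ri; rewrite -(subrK r p) lformD rpredD //.
  exact: row_latticeP wL i.
have r_half : `|rowval A i r| <= 2^-1.
  have r_norm : `|rowval A i r| = 2^-1 * `|rowval A i (scaled_ray h j)|.
    by rewrite lformZ normrM ger0_norm ?invr_ge0.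
  have := norm_scaled_ray_in j i hn; rewrite !inE r_norm.
  case/or3P=> /eqP ui; rewrite ui ?mulr0 ?mulr1 ?invr_ge0 //.
  by move: r_norm r_notint; rewrite ui mulVf ?pnatr_eq0 // => /eqP;
    rewrite eqr_norml => /andP[/orP[]/eqP-> _]; rewrite ?rpredN rpred1.
have p_half := half_int_ge (basis_lattice_half_int i h0n ph) pi (p0 i).
move: r_half; rewrite ler_norml mul1r => /andP[r_ge r_le_half].
by apply/andP; split; lra.
Qed.

End Rounding.

Section Decomposition.
Hypothesis pA : pointed R A predT.

Definition splits w := exists w', [/\ w' \in L, w' != 0, w' != w &
  forall i, 0 <= rowval A i w' <= rowval A i w].

Lemma primitive_ray w : w \in L -> in_cone A w -> w != 0 ->
  exists h j, let u := scaled_ray h j in [/\ minor A h != 0, u != 0,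
    forall i, rowval A i u \in [:: 0; 1; 2] &
    forall i, rowval A i u != 0 -> 1 <= rowval A i w].
Proof.
move=> wL w0 wn.
have [i0 _ wi0] := pointed_exists_gt0 pA (fun i _ => w0 i) (elimN eqP wn).
have [h [j [_ hj hn ray0 ray_face]]] :=
  extreme_ray (S := predT) pA (fun i _ => w0 i) isT wi0.
exists h, j; split=> // [|i|i].
- apply: contraNneq hn => u0; rewrite -normr_eq0 -(intr_eq0 R).
  have := rowval_scaled_ray h j i0; rewrite u0 lform0 -hj mulmx_ray_basis eqxx.
  by move/esym/eqP; rewrite mulf_eq0 invr_eq0 (gt_eqF gR) orbF.
- rewrite -[rowval A i _]ger0_norm ?norm_scaled_ray_in //.
  by rewrite rowval_scaled_ray divr_ge0 // ler0z ray0.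
- rewrite rowval_scaled_ray => rayi; apply: intr_gt0_ge1;
  first exact: row_latticeP.
  rewrite lt_def w0 andbT; apply: contraNneq rayi => /(ray_face i isT) ->.
  by rewrite mul0r.
Qed.

Lemma sub_half_ray_lattice w h j i1 : let h' := [eta h with j |-> i1] in
    w \in L -> minor A h != 0 -> rowval A i1 (scaled_ray h j) = 2 ->
  minor A h' != 0 /\ w - 2^-1 *: scaled_ray h j \in 'L_h'.
Proof.
move=> h' wL hn ui1; split.
  rewrite -absz_eq0; apply/eqP => h'0; have := norm_scaled_ray j i1 hn.
  by rewrite ui1 h'0 mul0r => /eqP; rewrite normr_eq0 pnatr_eq0.
apply/basis_latticeP => l.
rewrite lformB lformZ rpredB ?(row_latticeP wL) // /h' /=.
case: eqP => [_|/eqP lj]; first by rewrite ui1 mulVf ?pnatr_eq0 ?rpred1.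
by rewrite rowval_scaled_ray mulmx_ray_basis (negbTE lj) mul0r mulr0 rpred0.
Qed.

(* [w - u / 2] is integral on a basis, hence rounds to the lattice: this
   leaves a smaller lattice vector unless [w] is the sum of two half rays. *)
Lemma half_ray_split w h j i1 : let u := scaled_ray h j in
    w \in L -> in_cone A w -> minor A h != 0 ->
    (forall i, rowval A i u \in [:: 0; 1; 2]) ->
    (forall i, rowval A i u != 0 -> 1 <= rowval A i w) ->
    rowval A i1 u = 2 -> 2^-1 *: u \notin L ->
  gauge_le A w g%:R^-1 \/ splits w.
Proof.
move=> u wL w0 hn u012 u_supp ui1 uL; set q := w - 2^-1 *: u.
have qE i : rowval A i q = rowval A i w - 2^-1 * rowval A i u.
  by rewrite lformB lformZ.
have q0 i : 0 <= rowval A i q.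
  by rewrite qE subr_ge0; apply: half_value_le (u_supp i).
have qL : q \notin L by rewrite rpredBl.
have [h'n qh'] := sub_half_ray_lattice wL hn ui1.
have [w' [w'L w'_le gauge_q]] := lattice_rounding h'n qh' qL q0.
have w'w i : 0 <= rowval A i w' <= rowval A i w.
  have /andP[-> /le_trans] := w'_le i; apply; rewrite qE.
  case: (boolP (_ \is a Num.int)) => [_|]; last first.
    have := u012 i; rewrite !inE => /or3P[] /eqP -> qi.
    - by move: qi; rewrite mulr0 subr0 (row_latticeP wL).
    - by rewrite mulr1 mul1r subrK.
    - move: qi; rewrite mulVf ?pnatr_eq0 //.
      by rewrite rpredB ?rpred1 ?(row_latticeP wL).
  rewrite mul0r addr0 gerBl mulr_ge0 ?invr_ge0 //.
  by have := u012 i; rewrite !inE => /or3P[] /eqP ->.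
have [w'0|w'n] := eqVneq w' 0; [left | right].
  have -> : w = 2^-1 *: u + (q - w') by rewrite w'0 subr0 addrC subrK.
  have -> : g%:R^-1 = 2^-1 / g%:R + (2 * g)%:R^-1 :> R.
    by rewrite natrM invfM -mulrDl -[LHS]mul1r; congr (_ * _); lra.
  by apply: gauge_leD gauge_q; apply: gauge_le_scaled_ray; rewrite invr_ge0.
exists w'; split=> //; apply: contraTneq (w'_le i1) => ->.
rewrite qE ui1 mulVf ?pnatr_eq0 // rpredB ?rpred1 ?(row_latticeP wL) //.
by rewrite mul0r addr0; apply/negP => /andP[_]; lra.
Qed.

Lemma lattice_split w : w \in L -> in_cone A w -> w != 0 ->
  gauge_le A w g%:R^-1 \/ splits w.
Proof.
move=> wL w0 wn; have [h [j []]] := primitive_ray wL w0 wn.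
set u := scaled_ray h j => hn un u012 u_supp.
have u0 i : 0 <= rowval A i u.
  by have := u012 i; rewrite !inE => /or3P[] /eqP ->.
have split_off c : 0 < c <= 1 -> c *: u \in L ->
    (forall i, c * rowval A i u <= rowval A i w) ->
  gauge_le A w g%:R^-1 \/ splits w.
  move=> /andP[c0 c1] cuL cu_le; have [wE|w_cu] := eqVneq w (c *: u);
    [left|right].
    rewrite wE; apply: gauge_leW (gauge_le_scaled_ray _ _ (ltW c0)).
    by rewrite ler_piMl ?invr_ge0.
  exists (c *: u); split=> // [||i].
  - by rewrite scaler_eq0 negb_or un gt_eqF.
  - by rewrite eq_sym.
  - by rewrite lformZ cu_le mulr_ge0 // ltW.
have [[i1 ui1]|/forallNP u_neq2] := pselect (exists i, rowval A i u = 2).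
  have [uL|uL] := boolP (2^-1 *: u \in L); last first.
    exact: half_ray_split wL w0 hn u012 u_supp ui1 uL.
  apply: split_off uL _ => [|i]; first by apply/andP; split; lra.
  exact: half_value_le (u_supp i).
apply: (split_off 1) => [||i]; rewrite ?ltr01 ?lexx // ?scale1r ?mul1r.
  apply/row_latticeP => i; have := u012 i.
  by rewrite !inE => /or3P[] /eqP ->; rewrite ?rpred0 ?rpred1 ?rpred_nat.
have := u012 i; rewrite !inE => /or3P[] /eqP uiE; rewrite uiE //.
  by apply: u_supp; rewrite uiE oner_eq0.
by case: (u_neq2 i).
Qed.

Lemma lattice_decomposition w : w \in L -> in_cone A w ->
  exists2 ws : seq 'cV[R]_n, \sum_(x <- ws) x = w &
    {in ws, forall x, [/\ x \in L, in_cone A x, x != 0 &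
                          gauge_le A x g%:R^-1]}.
Proof.
pose f (x : 'cV[R]_n) := \sum_i rowval A i x.
have f_ge1 x : x \in L -> in_cone A x -> x != 0 -> 1 <= f x.
  move=> xL x0 xn.
  have [i _ xi] := pointed_exists_gt0 pA (fun i _ => x0 i) (elimN eqP xn).
  have xi1 := intr_gt0_ge1 (row_latticeP xL i) xi.
  by rewrite /f (bigD1 i) //= ler_wpDr ?sumr_ge0.
elim/(archi_descent (f := f)): w => w IH wL w0.
have [->|wn] := eqVneq w 0; first by exists [::]; rewrite ?big_nil.
have [w_gauge|[x [xL xn xw x_le]]] := lattice_split wL w0 wn.
  by exists [:: w]; rewrite ?big_seq1 // => y; rewrite inE => /eqP ->.
have x0 : in_cone A x by move=> i; case/andP: (x_le i).
have wxL : w - x \in L by rewrite rpredB.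
have wx0 : in_cone A (w - x).
  by move=> i; rewrite lformB subr_ge0; case/andP: (x_le i).
have f_sub : f (w - x) = f w - f x.
  by rewrite /f -sumrB; apply: eq_bigr => i _; rewrite lformB.
have fx := f_ge1 _ xL x0 xn; have fwx : 1 <= f (w - x).
  by apply: f_ge1 => //; rewrite subr_eq0 eq_sym.
have [|xs xsE xsP] := IH x _ xL x0; first by apply/andP; split; lra.
have [|ys ysE ysP] := IH (w - x) _ wxL wx0; first by apply/andP; split; lra.
exists (xs ++ ys); first by rewrite big_cat /= xsE ysE addrC subrK.
by move=> y; rewrite mem_cat => /orP[/xsP|/ysP].
Qed.

End Decomposition.

End BimodularLattice.

Lemma pigeonhole (T : finType) (f : nat -> T) :
  exists i j, (i < j <= #|T|)%N /\ f i = f j.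
Proof.
have /injectivePn[i [j nij fij]] : ~~ injectiveb (fun i : 'I_#|T|.+1 => f i).
  by apply/injectiveP => /leq_card; rewrite card_ord ltnn.
have [ij|ji|/val_inj eij] := ltngtP i j; last by rewrite eij eqxx in nij.
  by exists i, j; rewrite ij -ltnS ltn_ord.
by exists j, i; rewrite ji -ltnS ltn_ord.
Qed.

Lemma diagonal_lattice_pigeonhole (n : nat) (e : 'I_n -> int)
    (x : nat -> 'I_n -> int) : (forall t, e t != 0) ->
  exists i j, (i < j <= \prod_t absz (e t))%N /\
    forall t, (e t %| x j t - x i t)%Z.
Proof.
move=> e0; have mod_lt i t : (absz (x i t %% e t)%Z < absz (e t))%N.
  by rewrite -ltz_nat gez0_abs ?modz_ge0 // abszE ltz_mod.
pose residues i : {dffun forall t, 'I_(absz (e t))} :=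
  [ffun t => Ordinal (mod_lt i t)].
have [i [j [ij eq_res]]] := pigeonhole residues.
exists i, j; split=> [|t].
  move: ij; rewrite card_dep_ffun foldrE big_map enumT.
  by under eq_bigr do rewrite card_ord.
have /(congr1 val) /= mod_eq : residues i t = residues j t by rewrite eq_res.
move: mod_eq; rewrite !ffunE /= => mod_eq; rewrite -eqz_mod_dvd eq_sym;
  apply/eqP.
by rewrite -[LHS](gez0_abs (modz_ge0 _ (e0 t))) mod_eq gez0_abs ?modz_ge0.
Qed.

(* By the Smith normal form, B Z^n has index |det B| in Z^n. *)
Lemma lattice_pigeonhole (n : nat) (B : 'M[int]_n) (X : nat -> 'cV[int]_n) :
  \det B != 0 ->
  exists i j (z : 'cV[int]_n), (i < j <= absz (\det B))%N /\ X j - X i = B *m z.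
Proof.
move=> B0; have [L uL [U uU [d _ BE]]] := int_Smith_normal_form B.
pose e (t : 'I_n) : int := d`_t.
have DE : \matrix_(i, j) (d`_i *+ (i == j :> nat)) = diag_mx (\row_i e i).
  by apply/matrixP => i j; rewrite !mxE.
rewrite {}DE in BE.
have det_unit (M : 'M[int]_n) : M \in unitmx -> absz (\det M) = 1%N.
  by rewrite unitmxE qualifE /= => /orP[] /eqP ->.
have detB : absz (\det B) = (\prod_t absz (e t))%N.
  rewrite BE !det_mulmx !abszM (det_unit L) // (det_unit U) // mul1n muln1
    det_diag.
  by elim/big_rec2: _ => // i x y _ <-; rewrite mxE abszM.
have e0 t : e t != 0.
  by apply: contraNneq B0 => et; rewrite -absz_eq0 detB (bigD1 t) //= et mul0n.
have [i [j [ij dvd_e]]] :=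
  diagonal_lattice_pigeonhole (fun l t => (invmx L *m X l) t 0) e0.
pose v := invmx L *m (X j - X i).
exists i, j, (invmx U *m \col_t ((v t 0%R) %/ e t)%Z).
rewrite detB ij BE -!mulmxA mulKVmx //; split=> //.
rewrite -[LHS](mulKVmx uL) -/v; congr (_ *m _); apply/matrixP => t s.
have dvd_v : (e t %| v t 0%R)%Z.
  by rewrite /v mulmxBr mxE [X in (_ %| _ + X)%Z]mxE.
by rewrite ord1 mul_diag_mx [RHS]mxE [_ 0 t]mxE [X in _ * X]mxE mulrC divzK.
Qed.

Section IntegralBlocks.
Variables (R : archiRealFieldType) (m n : nat) (A : 'M[int]_(m, n)).

(* The partial sums of [ws] cannot be pairwise distinct modulo Z^n, which has
   index |minor A h| in the lattice of vectors integral on the rows [h]. *)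
Lemma integral_block h (ws : seq 'cV[R]_n) : minor A h != 0 ->
    {in ws, forall w, w \in row_lattice (rowsub h A)} ->
    (absz (minor A h) <= size ws)%N ->
  exists vs1 vs vs2 z, [/\ ws = vs1 ++ vs ++ vs2, vs != [::] &
    \sum_(w <- vs) w = map_mx intr z].
Proof.
move=> h0 wsL size_ws; pose s l := \sum_(w <- take l ws) w.
have s_int l t : rowval A (h t) (s l) \is a Num.int.
  have : s l \in row_lattice (rowsub h A).
    by rewrite /s big_seq rpred_sum // => w /mem_take/wsL.
  by move/basis_latticeP.
pose X l : 'cV[int]_n := \col_t Num.floor (rowval A (h t) (s l)).
have [i [j [z [/andP[ij j_le] XE]]]] := lattice_pigeonhole X h0.
have take_j : take j ws = take i ws ++ take (j - i) (drop i ws).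
  by rewrite -takeD subnKC // ltnW.
exists (take i ws), (take (j - i) (drop i ws)), (drop j ws), z; split.
- by rewrite catA -take_j cat_take_drop.
- rewrite -size_eq0 size_takel ?size_drop ?subn_eq0 -?ltnNge //.
  by rewrite leq_sub2r // (leq_trans j_le).
have -> : \sum_(w <- take (j - i) (drop i ws)) w = s j - s i.
  by rewrite /s take_j big_cat /= [X in X - _]addrC addrK.
apply/eqP; rewrite -subr_eq0; apply/eqP; apply: (basis_eq0 h0) => t.
rewrite !lformB rowval_intr -(floorK (s_int j t)) -(floorK (s_int i t)) -intrB.
have := congr1 (fun M : 'cV_n => M t 0) XE; rewrite mul_rowsub_mx !mxE => ->.
exact: subrr.
Qed.

End IntegralBlocks.

Section RowSigns.
Variables (m n : nat) (b : pred 'I_m) (A : 'M[int]_(m, n)).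

Definition flip_rows : 'M[int]_(m, n) := \matrix_(i, j) ((-1) ^+ b i * A i j).

Lemma mulmx_flip_rows (z : 'cV[int]_n) i :
  (flip_rows *m z) i 0 = (-1) ^+ b i * (A *m z) i 0.
Proof. by rewrite !mxE mulr_sumr; apply: eq_bigr => j _; rewrite mxE mulrA. Qed.

Lemma rowval_flip_rows (R : comPzRingType) i (y : 'cV[R]_n) :
  rowval flip_rows i y = (-1) ^+ b i * rowval A i y.
Proof.
rewrite !rowvalE !mxE mulr_sumr; apply: eq_bigr => j _.
by rewrite !mxE rmorphM /= rmorph_sign mulrA.
Qed.

Lemma absz_minor_flip_rows h : absz (minor flip_rows h) = absz (minor A h).
Proof.
rewrite /minor; have -> : rowsub h flip_rows =
    diag_mx (\row_j (-1) ^+ b (h j)) *m rowsub h A.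
  by apply/matrixP => i j; rewrite mul_diag_mx !mxE.
rewrite det_mulmx det_diag abszM [X in (X * _)%N](_ : _ = 1%N) ?mul1n //.
by elim/big_ind: _ => // [x y x1 y1|j _];
  rewrite ?abszM ?x1 ?y1 // mxE absz_sign.
Qed.

Lemma ray_flip_rows h j : ray flip_rows h j = (-1) ^+ b (h j) *: ray A h j.
Proof.
have minorE : `|minor flip_rows h| = `|minor A h|.
  by rewrite -!abszE absz_minor_flip_rows.
have [h0|h0] := eqVneq (minor A h) 0.
  rewrite !ray_singular ?scaler0 //.
  by apply/eqP; rewrite -normr_eq0 minorE h0 normr0.
suff : map_mx intr (ray flip_rows h j - (-1) ^+ b (h j) *: ray A h j)
    = 0 :> 'cV[rat]_n.
  by rewrite -(map_mx0 intr) => /map_mx_intr_inj/eqP; rewrite subr_eq0 => /eqP.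
apply: (basis_eq0 h0) => l; rewrite rowval_intr; apply/eqP; rewrite intr_eq0.
rewrite mulmxBr -(scalemxAr _ A (ray A h j)) mxE.
rewrite [X in _ + X]mxE [X in _ - X]mxE mulmx_ray_basis.
have -> : (A *m ray flip_rows h j) (h l) 0 =
    (-1) ^+ b (h l) * (`|minor A h| *+ (l == j)).
  by rewrite -minorE -mulmx_ray_basis mulmx_flip_rows signrMK.
by have [->|_] := eqVneq l j; rewrite ?mulr0 subrr.
Qed.

Lemma gauge_le_flip_rows (R : numDomainType) (y : 'cV[R]_n) c :
  gauge_le flip_rows y c -> gauge_le A y c.
Proof.
move=> yc a M aM; apply: yc => h j.
by rewrite ray_flip_rows -(scalemxAr _ a (ray A h j)) mxE abszMsign.
Qed.

End RowSigns.

Section LatticeProximity.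
Variables (R : archiRealFieldType) (m n g D : nat).
Hypothesis g0 : (0 < g)%N.
Implicit Types (A : 'M[int]_(m, n)) (h : 'I_n -> 'I_m) (p w : 'cV[R]_n).
Local Notation embed z := (map_mx intr z : 'cV[R]_n).

(* Among [g] or more pieces of [w] some consecutive ones add up to an integral
   vector, which would lie in the box below [w]. *)
Lemma lattice_gauge A h1 w : bimodular g A -> absz (minor A h1) = g ->
    w \in row_lattice A -> in_cone A w ->
    (forall z : 'cV[int]_n,
      (forall i, 0 <= rowval A i (embed z) <= rowval A i w) -> z = 0) ->
  gauge_le A w (1 - g%:R^-1).
Proof.
move=> bimA h1g wL w0 no_int.
have h1n : minor A h1 != 0 by rewrite -absz_gt0 h1g.
have pA : pointed R A predT by apply: (basis_pointed h1n).
have [ws wsE wsP] := lattice_decomposition g0 bimA pA wL w0.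
have gR : 0 < g%:R :> R by rewrite ltr0n.
have [size_ws|size_ws] := leqP g (size ws); last first.
  rewrite -wsE; apply: gauge_leW (gauge_le_sum (c := g%:R^-1) _); last first.
    by move=> x /wsP[].
  rewrite lerBrDr -[X in _ + X]mul1r -mulrDl ler_pdivrMr // mul1r natr1.
  by rewrite ler_nat.
have [||vs1 [vs [vs2 [z [wsv vs_n vsz]]]]] := integral_block (ws := ws) h1n.
- by move=> x /wsP[xL *]; apply/basis_latticeP => j; apply: row_latticeP.
- by rewrite h1g.
have sum_ge0 (s : seq 'cV[R]_n) i : {subset s <= ws} ->
    0 <= rowval A i (\sum_(x <- s) x).
  move=> s_ws; rewrite raddf_sum big_seq sumr_ge0 // => x /s_ws/wsP[_ x0 _ _].
  exact: x0.
have sub_vs1 : {subset vs1 <= ws} by move=> x xv; rewrite wsv mem_cat xv.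
have sub_vs : {subset vs <= ws} by move=> x xv; rewrite wsv !mem_cat xv orbT.
have sub_vs2 : {subset vs2 <= ws} by move=> x xv; rewrite wsv !mem_cat xv !orbT.
have z0 : z = 0.
  apply: no_int => i; rewrite -vsz sum_ge0 //= -wsE wsv !big_cat /= !lformD.
  by have := sum_ge0 _ i sub_vs1; have := sum_ge0 _ i sub_vs2; lra.
case: vs => [//|v vs] in vs_n vsz sub_vs {wsv} *.
have [_ v0 vn _] := wsP v (sub_vs v (mem_head _ _)); case/eqP: vn.
have sub_vs' : {subset vs <= ws}.
  by move=> x xv; apply: sub_vs; rewrite inE xv orbT.
apply: pA => i _; have := congr1 (rowval A i) vsz.
rewrite z0 map_mx0 lform0 big_cons lformD.
by have := v0 i; have := sum_ge0 _ i sub_vs'; lra.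
Qed.

Lemma nonneg_proximity A h1 h0 p : bimodular g A ->
    (forall h, (absz (minor A h) <= D)%N) -> absz (minor A h1) = g ->
    minor A h0 != 0 -> p \in row_lattice (rowsub h0 A) ->
    in_cone A p -> (forall z : 'cV[int]_n,
      (forall i, 0 <= rowval A i (embed z) < rowval A i p + 1) -> z = 0) ->
  gauge_le A p (1 - D%:R^-1).
Proof.
move=> bimA minor_le h1g h0n ph p0 no_int.
have gauge_mono k : (0 < k <= D)%N -> 1 - k%:R^-1 <= 1 - D%:R^-1 :> R.
  move=> /andP[k0 kD]; rewrite lerD2l lerN2 lef_pV2 ?posrE ?ltr0n ?ler_nat //.
  exact: leq_trans kD.
have [pL|pL] := boolP (p \in row_lattice A).
  apply: gauge_leW (lattice_gauge bimA h1g pL p0 _) => [|z z_box].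
    by apply: gauge_mono; rewrite g0 -h1g minor_le.
  apply: no_int => i; have /andP[-> z_le] := z_box i.
  by apply: le_lt_trans z_le _; rewrite ltrDl.
have [w [wL w_le gauge_pw]] := lattice_rounding g0 bimA h0n ph pL p0.
have w0 i : 0 <= rowval A i w by case/andP: (w_le i).
have w_lt i : rowval A i w < rowval A i p + 1.
  case/andP: (w_le i) => _ /le_lt_trans; apply.
  by case: (_ \isn't a _); rewrite /= ?mul0r ?mul1r; lra.
have gauge_w : gauge_le A w (1 - g%:R^-1).
  apply: lattice_gauge bimA h1g wL w0 _ => z z_box; apply: no_int => i.
  have /andP[-> z_le] := z_box i; exact: le_lt_trans z_le (w_lt i).
have := gauge_leD gauge_w gauge_pw; rewrite addrC subrK; apply: gauge_leW.
have -> : 1 - g%:R^-1 + (2 * g)%:R^-1 = 1 - (2 * g)%:R^-1 :> R.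
  by rewrite natrM; field; rewrite pnatr_eq0 -lt0n.
apply: gauge_mono; rewrite muln_gt0 g0 /=.
by rewrite -(nonlattice_basis_minor g0 bimA h0n ph pL) minor_le.
Qed.

Definition conformal A p (z : 'cV[int]_n) := forall i,
  if rowval A i p < 0 then rowval A i p - 1 < rowval A i (embed z) <= 0
  else 0 <= rowval A i (embed z) < rowval A i p + 1.

Lemma conformal_proximity A h1 h0 p : bimodular g A ->
    (forall h, (absz (minor A h) <= D)%N) -> absz (minor A h1) = g ->
    minor A h0 != 0 -> p \in row_lattice (rowsub h0 A) ->
    (forall z, conformal A p z -> z = 0) ->
  gauge_le A p (1 - D%:R^-1).
Proof.
move=> bimA minor_le h1g h0n ph no_conf; pose b i := rowval A i p < 0.
apply: (gauge_le_flip_rows (b := b)).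
apply: (nonneg_proximity (h1 := h1) (h0 := h0)) => [h|h|||| i|z z_box].
- by rewrite absz_minor_flip_rows.
- by rewrite absz_minor_flip_rows.
- by rewrite absz_minor_flip_rows.
- by rewrite -absz_eq0 absz_minor_flip_rows absz_eq0.
- apply/basis_latticeP => j; rewrite rowval_flip_rows rpredMsign.
  exact: (basis_latticeP ph).
- by rewrite rowval_flip_rows mulr_sign /b; case: ltP => // /ltW;
  rewrite oppr_ge0.
apply: no_conf => i; have := z_box i; rewrite !rowval_flip_rows !mulr_sign /b.
by case: ifP => // _ /andP[z0 zp]; apply/andP; split; lra.
Qed.

End LatticeProximity.

Lemma ex_argmax_int (T : Type) (P : T -> Prop) (f : T -> int) (B : int) :
    (exists t, P t) -> (forall t, P t -> f t <= B) ->
  exists2 t, P t & forall u, P u -> f u <= f t.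
Proof.
move=> [t0 Pt0] f_le; pose gap k :=
  `[< exists2 t, P t & absz (B - f t)%R = k >].
have gap_ex : exists k, gap k.
  by exists (absz (B - f t0)%R); apply/asboolP; exists t0.
case: (ex_minnP gap_ex) => k /asboolP[t Pt tk] k_min; exists t => // u Pu.
have : (k <= absz (B - f u)%R)%N by apply: k_min; apply/asboolP; exists u.
by have := f_le t Pt; have := f_le u Pu; lia.
Qed.

Section Polyhedra.
Variables (R : realType) (m n : nat) (A : 'M[int]_(m, n)) (b : 'cV[int]_m).
Implicit Types (x y d : 'cV[R]_n) (z t : 'cV[int]_n) (h : 'I_n -> 'I_m).

Lemma inP_feasible x : inP A b x <-> feasible A predT (fun i => (b i 0)%:~R) x.
Proof.
by split=> xP i => [_|]; have := xP i; rewrite rowvalE //; apply.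
Qed.

Lemma inPZ_inP z : inPZ A b z <-> inP A b (intvec R z).
Proof.
by split=> [zP|/inP_feasible zP i];
  [apply/inP_feasible => i _|have := zP i isT];
  rewrite rowval_intr ler_int.
Qed.

Lemma vertex_basis x : is_vertex (inP A b) x ->
  exists2 h, forall j, rowval A (h j) x = (b (h j) 0)%:~R & minor A h != 0.
Proof.
move=> [xP x_extreme]; pose T := [pred i | rowval A i x == (b i 0)%:~R].
have step d : (forall i, T i -> rowval A i d = 0) ->
    exists2 e, 0 < e & inP A b (x + e *: d).
  move=> dT; have xfeas := proj1 (inP_feasible x) xP.
  have [|e e0 eP] := feasible_direction (d := d) xfeas.
    by move=> i _ /eqP/dT ->.
  by exists e => //; apply/inP_feasible.
have [h hT hn] : exists2 h, forall j, T (h j) & minor A h != 0.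
  apply: (pointed_basis (R := R)) => d dT; have [e1 e1_gt0 P1] := step d dT.
  have [|e2 e2_gt0 P2] := step (- d).
    by move=> i /dT; rewrite lformN => ->; rewrite oppr0.
  have e12 : 0 < e1 + e2 by rewrite addr_gt0.
  have : x + e1 *: d = x + e2 *: - d.
    apply: (x_extreme _ _ (e2 / (e1 + e2))) => //.
      by rewrite divr_gt0 //= ltr_pdivrMr // mul1r ltrDr.
    by apply/matrixP => i j; rewrite !mxE; field; rewrite gt_eqF.
  move=> /addrI/eqP; rewrite scalerN -subr_eq0 opprK -scalerDl scaler_eq0.
  by rewrite gt_eqF //= => /eqP.
by exists h => // j; apply/eqP/hT.
Qed.

Lemma optimal_direction (c : {scalar 'cV[R]_n}) x d : inP A b x ->
    (forall y, inP A b y -> c y <= c x) ->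
    (forall i, rowval A i x = (b i 0)%:~R -> rowval A i d <= 0) -> c d <= 0.
Proof.
move=> xP x_opt dt.
have [|e e0 eP] := feasible_direction (d := d) (proj1 (inP_feasible x) xP).
  by move=> i _ /dt.
have /x_opt : inP A b (x + e *: d) by apply/inP_feasible.
by rewrite linearD scalarZ gerDl pmulr_rle0.
Qed.

Lemma conformal_feasible x z t : inP A b x -> inPZ A b z ->
  conformal A (x - intvec R z) t -> inPZ A b (z + t).
Proof.
move=> /inP_feasible xP zP tP i; rewrite mulmxDr mxE; have := tP i.
rewrite lformB !rowval_intr; case: ifP => _ /andP[].
  by rewrite lerz0 => _ ti; apply: le_trans (zP i); rewrite gerDl.
move=> _ ti; rewrite -ltzD1 -(ltr_int R) !intrD.
by have := xP i isT; move: ti; lra.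
Qed.

Lemma conformal_tight_ge0 x z t i : inPZ A b z ->
  conformal A (x - intvec R z) t -> rowval A i x = (b i 0)%:~R ->
    0 <= (A *m t) i 0.
Proof.
move=> zP tP xi; have := tP i; rewrite lformB xi !rowval_intr -intrB ltNge.
by rewrite ler0z subr_ge0 zP ler0z /= => /andP[].
Qed.

(* Among the optimal integral points, take one with the least total slack on
   the tight basis [h0]: no nonzero vector conformal to [x - z] can be added
   to it. *)
Lemma integer_proximity (g D : nat) h1 h0 (c : 'rV[int]_n) x : (0 < g)%N ->
    bimodular g A -> (forall h, (absz (minor A h) <= D)%N) ->
    absz (minor A h1) = g -> minor A h0 != 0 ->
    inP A b x -> (forall y, inP A b y -> lform c y <= lform c x) ->
    (forall j, rowval A (h0 j) x = (b (h0 j) 0)%:~R) ->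
    (exists z, inPZ A b z) ->
  exists z, [/\ inPZ A b z,
    forall z', inPZ A b z' -> (c *m z') 0 0 <= (c *m z) 0 0 &
    gauge_le A (x - intvec R z) (1 - D%:R^-1)].
Proof.
move=> g0 bimA minor_le h1g h0n xP x_opt h0t feas.
have [|z1 z1P z1_opt] := ex_argmax_int (f := fun z => (c *m z) 0 0)
    (B := Num.floor (lform c x)) feas.
  by move=> z /inPZ_inP/x_opt; rewrite floor_ge_int lform_intr.
pose optimal z := inPZ A b z /\ (c *m z) 0 0 = (c *m z1) 0 0.
have [||z [zP zc] z_max] := ex_argmax_int (P := optimal)
    (f := fun z => \sum_j (A *m z) (h0 j) 0) (B := \sum_j b (h0 j) 0).
- by exists z1.
- by move=> z [zP _]; apply: ler_sum => j _; apply: zP.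
exists z; split=> // [z' /z1_opt|]; first by rewrite zc.
apply: (conformal_proximity g0 bimA minor_le h1g h0n) => [|t tP].
  by apply/basis_latticeP => j; rewrite lformB rowval_intr h0t rpredB //
    rpred_int.
have t_ge0 i : rowval A i x = (b i 0)%:~R -> 0 <= (A *m t) i 0.
  exact: conformal_tight_ge0 zP tP.
have ztP := conformal_feasible xP zP tP.
have ct : 0 <= (c *m t) 0 0.
  rewrite -(ler0z R) -lform_intr -oppr_le0 -lformN.
  apply: (optimal_direction (c := lform c) xP x_opt) => i /t_ge0.
  by rewrite lformN rowval_intr oppr_le0 ler0z.
have zt_opt : optimal (z + t).
  split=> //; apply/eqP; rewrite eq_le z1_opt //= -zc mulmxDr [leRHS]mxE.
  by rewrite lerDl.
have /eqP : \sum_j (A *m t) (h0 j) 0 = 0.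
  apply/eqP; rewrite eq_le sumr_ge0 ?andbT => [|j _]; last exact: t_ge0.
  have := z_max _ zt_opt; under eq_bigr do rewrite mulmxDr mxE.
  by rewrite big_split /= gerDl.
rewrite psumr_eq0 => [/allP t0|j _]; last exact: t_ge0.
apply: (@map_mx_intr_inj R); rewrite map_mx0; apply: (basis_eq0 h0n) => j.
by rewrite rowval_intr (eqP (t0 j (mem_index_enum j))).
Qed.

End Polyhedra.

Section MinorBounds.
Variables (m n : nat) (A : 'M[int]_(m, n)).
Implicit Types (h : 'I_n -> 'I_m).

Lemma det_mxsub_le_Delta j (f : 'I_j -> 'I_m) (g : 'I_j -> 'I_n) : injective g ->
  (absz (\det (mxsub f g A)) <= Delta j A)%N.
Proof.
move=> g_inj; have [f_inj|] := boolP (injectiveb f); last first.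
  move=> /injectivePn[x [y nxy fxy]];
    rewrite (determinant_alternate nxy) ?absz0 //.
  by move=> l; rewrite !mxE fxy.
have -> : mxsub f g A = mxsub (finfun f) (finfun g) A.
  by apply/matrixP => x y; rewrite !mxE !ffunE.
have finfun_inj (k : nat) (u : 'I_j -> 'I_k) :
    injective u -> injectiveb (finfun u).
  by move=> u_inj; apply/injectiveP => x y; rewrite !ffunE; apply: u_inj.
apply: leq_trans (leq_bigmax_cond _ (finfun_inj _ f (injectiveP _ f_inj))).
exact: (leq_bigmax_cond _ (finfun_inj _ g g_inj)).
Qed.

Lemma minor_le_Delta h : (absz (minor A h) <= Delta n A)%N.
Proof. exact: det_mxsub_le_Delta. Qed.

Lemma ray_le_Delta h j l : (absz (ray A h j l 0%R) <= Delta n.-1 A)%N.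
Proof.
rewrite !mxE abszM absz_sg abszMsign;
  apply: leq_trans (leq_mul (leq_b1 _) (leqnn _)) _.
rewrite mul1n.
have -> : row' j (col' l (rowsub h A)) = mxsub (h \o lift j) (lift l) A.
  by apply/matrixP => x y; rewrite !mxE.
exact/det_mxsub_le_Delta/lift_inj.
Qed.

Lemma mulmx_ray_le_Delta h j i : (absz ((A *m ray A h j) i 0%R) <= Delta n A)%N.
Proof.
have [h0|h0] := eqVneq (minor A h) 0;
  first by rewrite ray_singular // mulmx0 mxE.
by rewrite absz_mulmx_ray // minor_le_Delta.
Qed.

Lemma Delta_pred_gt0 h : (0 < n)%N -> minor A h != 0 -> (0 < Delta n.-1 A)%N.
Proof.
move=> n0; apply: contraNltn; rewrite leqn0 => /eqP Delta0;
  pose j := Ordinal n0.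
have ray0 : ray A h j = 0.
  apply/matrixP => l k; apply/eqP; rewrite ord1 [X in _ == X]mxE -absz_eq0.
  by have := ray_le_Delta h j l; rewrite Delta0 leqn0.
have := mulmx_ray_basis A h j j; rewrite ray0 mulmx0 mxE eqxx => /esym/eqP.
by rewrite normr_eq0.
Qed.

Lemma gauge_le_row (R : numDomainType) (y : 'cV[R]_n) c i :
  gauge_le A y c -> `|rowval A i y| <= (Delta n A)%:R * c.
Proof. by apply=> h j; rewrite -row_mul mxE mulmx_ray_le_Delta. Qed.

Lemma gauge_le_norm_inf (R : realType) (y : 'cV[R]_n) c : 0 <= c ->
  gauge_le A y c -> norm_inf y <= (Delta n.-1 A)%:R * c.
Proof.
move=> c0 yc; apply: bigmax_le => [|l _]; first exact: mulr_ge0.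
by rewrite -lform_delta; apply: yc => h j; rewrite -rowE mxE ray_le_Delta.
Qed.

End MinorBounds.

Section Scale.
Variables (R : realType) (m n k : nat) (A : 'M[int]_(m, n)).
Hypothesis rankA : \rank (mxR R A) = n.

Lemma rank_pointed : pointed R A predT.
Proof.
move=> d d0; have full : row_full (mxR R A) by rewrite /row_full rankA.
apply: (row_full_inj full); rewrite mulmx0; apply/matrixP => i j.
by rewrite ord1 [RHS]mxE -[LHS]rowvalE d0.
Qed.

Lemma bimodular_of_minors :
  (forall (f : {ffun 'I_n -> 'I_m}) (g : {ffun 'I_n -> 'I_n}),
      injectiveb f -> injectiveb g ->
      \det (mxsub f g A) \in [:: 0; k%:Z; - k%:Z; (2 * k)%:Z; - (2 * k)%:Z]) ->
  bimodular k A.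
Proof.
move=> minorsA h; have [->|h0] := eqVneq (minor A h) 0; first by rewrite !inE.
have := minorsA (finfun h) (finfun id).
have -> : mxsub (finfun h) (finfun id) A = rowsub h A.
  by apply/matrixP => x y; rewrite !mxE !ffunE.
have -> : injectiveb (finfun h).
  by apply/injectiveP => x y; rewrite !ffunE; apply: (minor_inj h0).
have -> : injectiveb (finfun (@id 'I_n)).
  by apply/injectiveP => x y; rewrite !ffunE.
move=> /(_ isT isT); rewrite -/(minor A h) !inE.
by move=> /or4P[| | |/orP[|]] /eqP ->; rewrite ?abszN ?eqxx ?orbT.
Qed.

Lemma bimodular_attained : (0 < k)%N -> bimodular k A ->
  exists g h, [/\ (0 < g)%N, bimodular g A & absz (minor A h) = g].
Proof.
move=> k0 bimA; have [[h hk]|/forallNP no_k] :=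
  pselect (exists h, absz (minor A h) = k).
  by exists k, h.
have minor_cases h : absz (minor A h) = 0%N \/ absz (minor A h) = (2 * k)%N.
  by have := bimA h; rewrite !inE => /or3P[] /eqP;
    [left | move=> /no_k | right].
have [h _ h0] := pointed_basis rank_pointed; exists (2 * k)%N, h.
split=> [|h'|]; first by rewrite muln_gt0.
  by rewrite !inE; case: (minor_cases h') => ->; rewrite ?eqxx ?orbT.
by case: (minor_cases h) => // /eqP; rewrite absz_eq0 (negbTE h0).
Qed.

End Scale.

Lemma clear_denominators (R : realType) (n : nat) (c : 'cV[rat]_n) :
  exists (d : R) (c' : 'rV[int]_n),
    0 < d /\ forall x, lform c' x = d * cdot c x.
Proof.
pose d : int := \prod_j denq (c j 0).
exists d%:~R, (\row_j (numq (c j 0) * \prod_(i | i != j) denq (c i 0))).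
split=> [|x]; first by rewrite ltr0z prodr_gt0 // => j _; apply: denq_gt0.
rewrite /lform /cdot mxE mulr_sumr; apply: eq_bigr => j _; rewrite !mxE mulrA.
have -> : d = denq (c j 0) * \prod_(i | i != j) denq (c i 0).
  by rewrite /d (bigD1 j).
by congr (_ * _); rewrite /ratr !intrM; field; rewrite intr_eq0 denq_neq0.
Qed.

Lemma width_le (R : realType) (n : nat) (P : 'cV[R]_n -> Prop)
    (a : 'rV[R]_n) lo up :
  (forall x, P x -> lo <= (a *m x) 0 0 <= up) -> (width P a <= (up - lo)%:E)%E.
Proof.
move=> P_le; rewrite EFinB; apply: leeB.
  by apply: ge_ereal_sup => _ [x /P_le/andP[_ x_le] <-]; rewrite lee_fin.
by apply: le_ereal_inf_tmp => _ [x /P_le/andP[le_x _] <-]; rewrite lee_fin.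
Qed.

(* Raise right-hand sides to nonnegative values on an inclusion-minimal set
   of rows making the system solvable, which it is by 0 when all rows are
   raised. *)
Lemma critical_relaxation (m n : nat) (A : 'M[int]_(m, n)) (b : 'cV[int]_m) :
    (forall z, ~ inPZ A b z) ->
  exists (b' : 'cV[int]_m) i, [/\ forall l, b l 0 <= b' l 0,
    exists z, inPZ A b' z & forall z, inPZ A b' z -> b i 0 < (A *m z) i 0].
Proof.
move=> infeasible.
pose relax (J : {set 'I_m}) : 'cV[int]_m :=
  \col_l if l \in J then Num.max (b l 0) 0 else b l 0.
pose solvable J := `[< exists z, inPZ A (relax J) z >].
have : solvable setT.
  by apply/asboolP; exists 0 => l; rewrite mulmx0 !mxE in_setT le_max lexx orbT.
case/minset_exists => J /minsetP[/asboolP[z zP] J_min] _.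
have [i iJ] : exists i, i \in J.
  apply/set0Pn; apply: contra_notN (infeasible z) => /eqP J0 l.
  by have := zP l; rewrite [leRHS]mxE J0 in_set0.
exists (relax J), i; split=> [l||z' z'P]; first 2 [by exists z].
  by rewrite mxE; case: ifP; rewrite // le_max lexx.
rewrite ltNge; apply/negP => z'i; have : solvable (J :\ i).
  apply/asboolP; exists z' => l; rewrite [leRHS]mxE in_setD1.
  by have := z'P l; rewrite [leRHS]mxE; have [->|//] := eqVneq l i.
by move/J_min => /(_ (subD1set _ _))/setP/(_ i); rewrite in_setD1 iJ eqxx.
Qed.

Lemma recession_row_ge0 (R : realFieldType) (m n : nat) (A : 'M[int]_(m, n)) b i
    (lo : int) (d : 'cV[R]_n) : pointed R A predT -> (exists z, inPZ A b z) ->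
    (forall z, inPZ A b z -> lo <= (A *m z) i 0) ->
  (forall l, rowval A l d <= 0) -> 0 <= rowval A i d.
Proof.
move=> pA [z zP] lo_le d0; rewrite leNgt; apply/negP => di.
have [l _||h [j [_ hj hn ray0 _]]] := extreme_ray (u := - d) (i0 := i) pA _ isT.
- by rewrite lformN oppr_ge0.
- by rewrite lformN oppr_gt0.
pose N : int := `|(A *m z) i 0 - lo| + 1.
have stepE l : (A *m (z - N *: ray A h j)) l 0 =
    (A *m z) l 0 - N * (A *m ray A h j) l 0.
  rewrite mulmxBr -(scalemxAr _ A (ray A h j)) [LHS]mxE [X in _ + X]mxE.
  by rewrite [X in _ - X]mxE.
have /lo_le : inPZ A b (z - N *: ray A h j).
  move=> l; rewrite stepE; apply: le_trans (zP l).
  by rewrite gerBl mulr_ge0 ?ray0 // addr_ge0.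
have ray_i : (A *m ray A h j) i 0 = `|minor A h|.
  by rewrite -hj mulmx_ray_basis eqxx.
rewrite stepE ray_i.
have N_le : N <= N * `|minor A h|.
  by rewrite ler_peMr -?gtz0_ge1 ?normr_gt0 ?addr_ge0.
have N_gt : (A *m z) i 0 - lo < N by rewrite ltzD1 ler_norm.
lia.
Qed.

Section BimodularPolyhedra.
Variables (R : realType) (m n g : nat) (A : 'M[int]_(m, n)) (h1 : 'I_n -> 'I_m).
Hypotheses (g0 : (0 < g)%N) (bimA : bimodular g A).
Hypothesis h1g : absz (minor A h1) = g.
Local Notation Dn := (Delta n A).
Local Notation Dn1 := (Delta n.-1 A).

Let h1n : minor A h1 != 0. Proof. by rewrite -absz_gt0 h1g. Qed.

Let Dn_gt0 : 0 < Dn%:R :> R.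
Proof. by rewrite ltr0n (leq_trans _ (minor_le_Delta A h1)) // h1g. Qed.

Lemma bimodular_proximity (b : 'cV[int]_m) (c : 'cV[rat]_n) (xs : 'cV[R]_n) :
    (0 < n)%N -> is_vertex (inP A b) xs ->
    (forall y, inP A b y -> cdot c y <= cdot c xs) -> (exists z, inPZ A b z) ->
  exists zs, [/\ inPZ A b zs,
    forall z, inPZ A b z -> cdot c (intvec R z) <= cdot c (intvec R zs),
    norm_inf (xs - intvec R zs) <= (maxn Dn1 Dn)%:R - 1 &
    norm_inf (xs - intvec R zs) < Dn1%:R].
Proof.
move=> n0 xs_vertex xs_opt feas.
have [h0 h0t h0n] := vertex_basis xs_vertex.
have [d [c' [d0 cE]]] := clear_denominators R c.
have [y yP|zs [zsP zs_opt zs_gauge]] := integer_proximity (c := c') g0 bimA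
  (minor_le_Delta A) h1g h0n xs_vertex.1 _ h0t feas.
  by rewrite !cE ler_pM2l // xs_opt.
have Dn1_gt0 : 0 < Dn1%:R :> R by rewrite ltr0n (Delta_pred_gt0 n0 h1n).
have Dn_inv0 : 0 < Dn%:R^-1 :> R by rewrite invr_gt0.
have Dn_inv1 : Dn%:R^-1 <= 1 :> R by rewrite invf_le1 // ler1n -(ltr0n R).
have := gauge_le_norm_inf _ zs_gauge; rewrite subr_ge0 => /(_ Dn_inv1) norm_le.
exists zs; split=> // [z zP||].
- by rewrite -(ler_pM2l d0) -!cE !lform_intr ler_int zs_opt.
- apply: le_trans norm_le _; have [D_le|D_le] := leqP Dn1 Dn.
    apply: le_trans (_ : Dn%:R * (1 - Dn%:R^-1) <= _).
      by rewrite ler_wpM2r ?subr_ge0 // ler_nat.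
    by rewrite mulrBr mulr1 divff ?gt_eqF.
  by rewrite mulrBr mulr1 lerD2l lerN2 ler_pdivlMr // mul1r ler_nat ltnW.
- by apply: le_lt_trans norm_le _; rewrite gtr_pMr // ltrBlDr ltrDl.
Qed.

(* Proximity in a critical relaxation, with row [i] minimized: the integral
   point found violates the original constraint [i] by at least 1. *)
Lemma bimodular_flatness (b : 'cV[int]_m) : (forall z, ~ inPZ A b z) ->
  exists i, (width (@inP R _ _ A b) (row i (mxR R A)) <= (Dn%:R - 2)%:E)%E.
Proof.
move=> /critical_relaxation[b' [i [b_le feas b_lt]]]; exists i.
have pA : pointed R A predT by apply: (basis_pointed h1n).
have [||x [h [xP x_opt ht hn]]] := lp_optimal_basis (c := lform (- row i A))
    (beta := fun l => (b' l 0)%:~R) pA.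
- by have [z /inPZ_inP/inP_feasible zP] := feas; exists (intvec R z).
- move=> d d0; rewrite /= lformNl oppr_le0.
  apply: (recession_row_ge0 (lo := b i 0) pA feas) => [z /b_lt/ltW //|l].
  exact: d0.
have [||z [zP _ z_gauge]] := integer_proximity (c := - row i A) g0 bimA
  (minor_le_Delta A) h1g hn _ _ ht feas.
- exact/inP_feasible.
- by move=> y /inP_feasible; apply: x_opt.
have := gauge_le_row i z_gauge.
rewrite lformB rowval_intr mulrBr mulr1 divff ?gt_eqF // ler_norml =>
  /andP[x_ge _].
have z_gt : (b i 0 + 1)%:~R <= ((A *m z) i 0)%:~R :> R.
  by rewrite ler_int lezD1 b_lt.
have row_bounds y : inP A b y ->
    rowval A i x <= (row i (mxR R A) *m y) 0 0 <= (b i 0)%:~R.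
  move=> /inP_feasible yP; rewrite -row_mul mxE.
  rewrite -[X in _ <= X <= _]rowvalE yP // andbT.
  rewrite -lerN2 -!lformNl; apply: x_opt => l _; apply: le_trans (yP l isT) _.
  by rewrite ler_int.
apply: le_trans (width_le row_bounds) _; rewrite lee_fin.
by move: x_ge z_gt; rewrite intrD; lra.
Qed.

End BimodularPolyhedra.

Theorem theorem6 (R : realType) (m n : nat) (A : 'M[int]_(m, n)) (k : nat) :
  (2 <= n)%N ->
  \rank (mxR R A) = n ->
  (1 <= k)%N ->
  (forall (f : {ffun 'I_n -> 'I_m}) (g : {ffun 'I_n -> 'I_n}),
      injectiveb f -> injectiveb g ->
      \det (mxsub f g A) \in [:: 0; k%:Z; - k%:Z; (2 * k)%:Z; - (2 * k)%:Z]) ->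
  (* (1) proximity *)
  (forall (b : 'cV[int]_m) (c : 'cV[rat]_n) (xs : 'cV[R]_n),
      is_vertex (@inP R _ _ A b) xs ->
      (forall y, @inP R _ _ A b y ->
         cdot c y <= cdot c xs) ->
      (exists z : 'cV[int]_n, inPZ A b z) ->
      exists zs : 'cV[int]_n,
        [/\ inPZ A b zs,
            (forall z : 'cV[int]_n, inPZ A b z ->
               cdot c (intvec R z) <= cdot c (intvec R zs)),
            norm_inf (xs - intvec R zs)
              <= (maxn (Delta n.-1 A) (Delta n A))%:R - 1
          & norm_inf (xs - intvec R zs) < (Delta n.-1 A)%:R]) /\
  (* (2) flatness *)
  (forall b : 'cV[int]_m,
      full_dim (@inP R _ _ A b) ->
      (forall z : 'cV[int]_n, ~ inPZ A b z) ->
      (forall i : 'I_m, row_facet R A b i) ->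
      exists i : 'I_m,
        (width (@inP R _ _ A b) (row i (mxR R A)) <= ((Delta n A)%:R - 2)%:E)%E).
Proof.
move=> n2 rankA k0 minorsA.
have [g [h1 [g0 bimA h1g]]] :=
  bimodular_attained rankA k0 (bimodular_of_minors minorsA).
split=> [b c xs xs_vertex xs_opt feas|b _ infeasible _].
  exact: (bimodular_proximity g0 bimA h1g (ltnW n2) xs_vertex xs_opt feas).
exact: (bimodular_flatness R g0 bimA h1g infeasible).
Qed.
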